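(* Let $d\in\mathbb{N}^*$, let $a<b$ be reals, let $0<\alpha\le 1$, let $N\ge 2$ be an integer, $h=(b-a)/N$, $t_k=a+kh$ for $k=0,\ldots,N$. Let $L:\mathbb{R}^d\times\mathbb{R}^d\times[a,b]\to\mathbb{R}$, $(x,v,t)\mapsto L(x,v,t)$, be a Lagrangian (a $C^2$ map) which is $\Delta^\alpha_-$-invariant under the action of a one parameter group of diffeomorphisms $\Phi=\{\phi(s,\cdot)\}_{s\in\mathbb{R}}$ of $\mathbb{R}^d$. Then, for any solution $\boldsymbol{Q}=(Q_k)_{k=0,\ldots,N}\in(\mathbb{R}^d)^{N+1}$ of the discrete fractional Euler-Lagrange equation $$\forall k=1,\ldots,N-1,\qquad \frac{\partial L}{\partial x}\big(Q_k,(\Delta^\alpha_-\boldsymbol{Q})_k,t_k\big)+\Delta^\alpha_+\left(\frac{\partial L}{\partial v}(\boldsymbol{Q},\Delta^\alpha_-\boldsymbol{Q},\boldsymbol{T})\right)_k=0,$$ the following equality holds for every $k=1,\ldots,N-1$: $$\Delta^\alpha_-\left(\frac{\partial\phi}{\partial s}(0,\boldsymbol{Q})\right)_k\cdot\frac{\partial L}{\partial v}\big(Q_k,(\Delta^\alpha_-\boldsymbol{Q})_k,t_k\big)-\frac{\partial\phi}{\partial s}(0,Q_k)\cdot\Delta^\alpha_+\left(\frac{\partial L}{\partial v}(\boldsymbol{Q},\Delta^\alpha_-\boldsymbol{Q},\boldsymbol{T})\right)_k=0 .$$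
   Context: Coefficients: $\alpha_0:=1$ and, for every integer $r\ge 1$, $\alpha_r:=\dfrac{(-\alpha)(1-\alpha)\cdots(r-1-\alpha)}{r!}$. Discrete fractional derivatives (Grünwald-Letnikov): for $\boldsymbol{Q}=(Q_k)_{k=0,\ldots,N}\in(\mathbb{R}^d)^{N+1}$, $$(\Delta^\alpha_-\boldsymbol{Q})_k:=\frac{1}{h^\alpha}\sum_{r=0}^{k}\alpha_r Q_{k-r}\ \ (k=1,\ldots,N),\qquad (\Delta^\alpha_+\boldsymbol{Q})_k:=\frac{1}{h^\alpha}\sum_{r=0}^{N-k}\alpha_r Q_{k+r}\ \ (k=0,\ldots,N-1).$$ $\boldsymbol{T}:=(t_k)_{k=0,\ldots,N}$. Functions of discrete elements are understood componentwise: $\phi(s,\boldsymbol{Q})=(\phi(s,Q_k))_{k=0,\ldots,N}$, $\frac{\partial\phi}{\partial s}(0,\boldsymbol{Q})=\big(\frac{\partial\phi}{\partial s}(0,Q_k)\big)_{k=0,\ldots,N}$, and the $k$-th entry of $\frac{\partial L}{\partial v}(\boldsymbol{Q},\Delta^\alpha_-\boldsymbol{Q},\boldsymbol{T})$ is $P_k:=\frac{\partial L}{\partial v}\big(Q_k,(\Delta^\alpha_-\boldsymbol{Q})_k,t_k\big)$ for $k=1,\ldots,N$; for $1\le k\le N-1$, $\Delta^\alpha_+(\cdot)_k$ of it is $\frac{1}{h^\alpha}\sum_{r=0}^{N-k}\alpha_r P_{k+r}$, which only involves entries with index $\ge1$. Here $\frac{\partial L}{\partial x}$ and $\frac{\partial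 L}{\partial v}$ are the gradients with respect to the first and second $\mathbb{R}^d$ variables, and $\cdot$ is the Euclidean inner product of $\mathbb{R}^d$. One parameter group of diffeomorphisms: a family $\Phi=\{\phi(s,\cdot)\}_{s\in\mathbb{R}}$ of diffeomorphisms $\phi(s,\cdot):\mathbb{R}^d\to\mathbb{R}^d$ such that (1) $\phi(0,\cdot)=\mathrm{Id}_{\mathbb{R}^d}$; (2) $\phi(s,\cdot)\circ\phi(s',\cdot)=\phi(s+s',\cdot)$ for all $s,s'\in\mathbb{R}$; (3) $\phi:\mathbb{R}\times\mathbb{R}^d\to\mathbb{R}^d$ is of class $C^2$. $\Delta^\alpha_-$-invariance: $L$ is said to be $\Delta^\alpha_-$-invariant under the action of $\Phi$ if for every solution $\boldsymbol{Q}\in(\mathbb{R}^d)^{N+1}$ of the discrete fractional Euler-Lagrange equation displayed in the claim and every $s\in\mathbb{R}$, $L\big(\phi(s,\boldsymbol{Q}),\Delta^\alpha_-(\phi(s,\boldsymbol{Q})),\boldsymbol{T}\big)=L(\boldsymbol{Q},\Delta^\alpha_-\boldsymbol{Q},\boldsymbol{T})$, i.e. for every $k=1,\ldots,N$, $$L\big(\phi(s,Q_k),\Delta^\alpha_-(\phi(s,\boldsymbol{Q}))_k,t_k\big)=L\big(Q_k,(\Delta^\alpha_-\boldsymbol{Q})_k,t_k\big).$$ *)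

(* Defs.v *)
From HB Require Import structures.
From mathcomp Require Import all_boot all_order all_algebra.
From mathcomp Require Import all_classical all_reals all_analysis.

Set Implicit Arguments.
Unset Strict Implicit.
Unset Printing Implicit Defensive.

Import Order.TTheory GRing.Theory Num.Theory.
Import numFieldNormedType.Exports.

Local Open Scope classical_set_scope.
Local Open Scope ring_scope.

(* For U open in a finite-dimensional V: continuity of x |-> 'd f x in operator
   norm amounts to continuity of every x |-> 'D_v f x. *)
Fixpoint Ck (R : realType) (V W : normedModType R) (k : nat)
    (U : set V) (f : V -> W) : Prop :=
  if k is k'.+1 then
    (forall x, U x -> differentiable f x) /\
    (forall v, Ck k' U (fun x => 'D_v f x))
  else forall x, U x -> {for x, continuous f}.

(* Class C^k on a subset D that need not be open: f coincides on D with a map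
   of class C^k on an open neighbourhood of D. *)
Definition Ck_on (R : realType) (V W : normedModType R) (k : nat)
    (D : set V) (f : V -> W) : Prop :=
  exists (U : set V) (g : V -> W),
    [/\ open U, D `<=` U, Ck k U g & forall x, D x -> f x = g x].

Section VectorCalculus.
Variables (R : realType) (d : nat).

Definition dotprod (u v : 'rV[R]_d) : R := \sum_(i < d) u 0 i * v 0 i.

Definition grad (f : 'rV[R]_d -> R) (x : 'rV[R]_d) : 'rV[R]_d :=
  \row_(i < d) 'D_(delta_mx 0 i) f x.

Definition diffeomorphism (f : 'rV[R]_d -> 'rV[R]_d) : Prop :=
  exists g : 'rV[R]_d -> 'rV[R]_d,
    [/\ cancel f g, cancel g f, Ck 1 setT f & Ck 1 setT g].

Definition one_parameter_group (phi : R -> 'rV[R]_d -> 'rV[R]_d) : Prop :=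
  [/\ forall s, diffeomorphism (phi s),
      phi 0 = id,
      forall s s', phi s \o phi s' = phi (s + s')
    & Ck 2 setT (fun p : R * 'rV[R]_d => phi p.1 p.2)].

(* dphi/ds (0, x) *)
Definition infinitesimal_generator (phi : R -> 'rV[R]_d -> 'rV[R]_d)
    (x : 'rV[R]_d) : 'rV[R]_d :=
  derive1 (fun s => phi s x) 0.

(* L is a function on R^d x R^d x [a, b]; as a total function of t, its values
   for t outside [a, b] are irrelevant everywhere below. *)
Definition lagrangian (a b : R) (L : 'rV[R]_d -> 'rV[R]_d -> R -> R) : Prop :=
  Ck_on 2 [set p : 'rV[R]_d * 'rV[R]_d * R | a <= p.2 <= b]
    (fun p => L p.1.1 p.1.2 p.2).

Definition dLdx (L : 'rV[R]_d -> 'rV[R]_d -> R -> R) (x v : 'rV[R]_d) (t : R) :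
  'rV[R]_d := grad (fun y => L y v t) x.

Definition dLdv (L : 'rV[R]_d -> 'rV[R]_d -> R -> R) (x v : 'rV[R]_d) (t : R) :
  'rV[R]_d := grad (fun w => L x w t) v.

End VectorCalculus.

Section Discrete.
Variables (R : realType) (d : nat) (a b alpha : R) (N : nat).

Definition step : R := (b - a) / N%:R.

Definition node (k : 'I_N.+1) : R := a + k%:R * step.

Definition GL_coef (r : nat) : R := (\prod_(j < r) (j%:R - alpha)) / (r`!)%:R.

(* The indices k - r and k + r below lie in {0, ..., N}, so [inord] is exact.
   Delta_minus is only meaningful for k >= 1 and Delta_plus for k < N; the
   remaining entries are never used. *)
Definition Delta_minus (Q : 'I_N.+1 -> 'rV[R]_d) (k : 'I_N.+1) : 'rV[R]_d :=
  (step `^ alpha)^-1 *: \sum_(r < k.+1) GL_coef r *: Q (inord (k - r)).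

Definition Delta_plus (Q : 'I_N.+1 -> 'rV[R]_d) (k : 'I_N.+1) : 'rV[R]_d :=
  (step `^ alpha)^-1 *: \sum_(r < (N - k).+1) GL_coef r *: Q (inord (k + r)).

Variable L : 'rV[R]_d -> 'rV[R]_d -> R -> R.

Definition momentum (Q : 'I_N.+1 -> 'rV[R]_d) (k : 'I_N.+1) : 'rV[R]_d :=
  dLdv L (Q k) (Delta_minus Q k) (node k).

Definition discrete_EL (Q : 'I_N.+1 -> 'rV[R]_d) : Prop :=
  forall k : 'I_N.+1, (0 < k < N)%N ->
    dLdx L (Q k) (Delta_minus Q k) (node k) + Delta_plus (momentum Q) k = 0.

Definition Delta_minus_invariant (phi : R -> 'rV[R]_d -> 'rV[R]_d) : Prop :=
  forall Q : 'I_N.+1 -> 'rV[R]_d, discrete_EL Q ->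
  forall (s : R) (k : 'I_N.+1), (0 < k)%N ->
    L (phi s (Q k)) (Delta_minus (fun j => phi s (Q j)) k) (node k) =
    L (Q k) (Delta_minus Q k) (node k).

End Discrete.

(* Main.v *)
(** Along a solution, the Lagrangian evaluated on the curve
    [s |-> (phi s Q_k, Delta_minus (phi s Q) k, t_k)] is constant by invariance.
    Differentiating at [s = 0] and using that [Delta_minus] is linear in the
    sequence, the chain rule gives [X_k . dL/dx + (Delta_minus X)_k . dL/dv = 0],
    where [X] is the infinitesimal generator along [Q]; the Euler-Lagrange
    equation replaces [dL/dx] by [- Delta_plus (dL/dv)]. *)
From HB Require Import structures.
Require Import Defs.
From mathcomp Require Import all_boot all_order all_algebra.
From mathcomp Require Import all_classical all_reals all_analysis.
Import Order.TTheory GRing.Theory Num.Theory.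
Import numFieldNormedType.Exports.
Local Open Scope ring_scope.

(** Both sides are limits of literally the same difference quotient, so they agree whether or not
    that limit exists. *)
Lemma derive_partial1 (R : realType) (U V W : normedModType R) (g : U * V -> W)
    (x u : U) (y : V) :
  'D_u (fun z => g (z, y)) x = 'D_(u, 0) g (x, y).
Proof.
rewrite /derive; set F := (X in _ = lim (fmap X _)).
suff -> : F = fun h : R => h^-1 *: (((fun z => g (z, y)) \o shift x) (h *: u) - g (x, y)) by [].
apply/funext => h; rewrite /F /=.
by rewrite (_ : h *: (u, 0) + (x, y) = (h *: u + x, y))//; congr pair; rewrite /= scaler0 add0r.
Qed.

Lemma derive_partial2 (R : realType) (U V W : normedModType R) (g : U * V -> W)
    (x : U) (y v : V) :
  'D_v (fun z => g (x, z)) y = 'D_(0, v) g (x, y).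
Proof.
rewrite /derive; set F := (X in _ = lim (fmap X _)).
suff -> : F = fun h : R => h^-1 *: (((fun z => g (x, z)) \o shift y) (h *: v) - g (x, y)) by [].
apply/funext => h; rewrite /F /=.
by rewrite (_ : h *: (0, v) + (x, y) = (x, h *: v + y))//; congr pair; rewrite /= scaler0 add0r.
Qed.

Lemma linear_dotprod (R : realType) (d : nat) (f : {linear 'rV[R]_d -> R})
    (u : 'rV[R]_d) :
  f u = dotprod u (\row_i f (delta_mx 0 i)).
Proof.
rewrite {1}(row_sum_delta u) linear_sum; apply: eq_bigr => i _.
by rewrite linearZ mxE.
Qed.

Lemma dotprodNr (R : realType) (d : nat) (u v : 'rV[R]_d) :
  dotprod u (- v) = - dotprod u v.
Proof. by rewrite -sumrN; apply: eq_bigr => i _; rewrite mxE mulrN. Qed.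

(** With time frozen, the tangent vector splits as [(u, 0, 0) + (0, w, 0)]; on each summand the
    differential is a linear form, given by its values on the canonical basis, and these are the
    partial derivatives. *)
Lemma diff_dotprod_grad (R : realType) (d : nat)
    (g : 'rV[R]_d * 'rV[R]_d * R -> R) (x v u w : 'rV[R]_d) (t : R) :
  differentiable g (x, v, t) ->
  'd g (x, v, t) (u, w, 0) =
  dotprod u (grad (fun y => g (y, v, t)) x)
  + dotprod w (grad (fun y => g (x, y, t)) v).
Proof.
move=> dg.
have -> : (u, w, 0) = (u, 0, 0) + (0, w, 0) :> 'rV[R]_d * 'rV[R]_d * R.
  by congr (pair (pair _ _) _); rewrite /= ?addr0 ?add0r.
rewrite linearD; congr (_ + _).
  have lin1 : linear (fun z : 'rV[R]_d => 'd g (x, v, t) (z, 0, 0)).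
    move=> c y z; rewrite -linearP; congr ('d _ _ _).
    by congr (pair (pair _ _) _); rewrite /= ?scaler0 ?addr0.
  pose l1 : {linear 'rV[R]_d -> R} :=
    HB.pack (fun z : 'rV[R]_d => 'd g (x, v, t) (z, 0, 0))
            (GRing.isLinear.Build _ _ _ _ _ lin1).
  rewrite -[LHS]/(l1 u) linear_dotprod; congr dotprod.
  apply/rowP => i; rewrite !mxE /l1 /= -deriveE//.
  (* Triples are nested pairs: the first rewrite freezes [t], the second freezes [v]. *)
  by rewrite -derive_partial1 -(derive_partial1 _ _ _ _ (fun p => g (p, t))).
have lin2 : linear (fun z : 'rV[R]_d => 'd g (x, v, t) (0, z, 0)).
  move=> c y z; rewrite -linearP; congr ('d _ _ _).
  by congr (pair (pair _ _) _); rewrite /= ?scaler0 ?addr0.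
pose l2 : {linear 'rV[R]_d -> R} :=
  HB.pack (fun z : 'rV[R]_d => 'd g (x, v, t) (0, z, 0))
          (GRing.isLinear.Build _ _ _ _ _ lin2).
rewrite -[LHS]/(l2 w) linear_dotprod; congr dotprod.
apply/rowP => i; rewrite !mxE /l2 /= -deriveE//.
by rewrite -derive_partial1 -(derive_partial2 _ _ _ _ (fun p => g (p, t))).
Qed.

Lemma is_derive_generator (R : realType) (d : nat)
    (phi : R -> 'rV[R]_d -> 'rV[R]_d) (x : 'rV[R]_d) :
  one_parameter_group phi ->
  is_derive (0 : R) 1 (fun s => phi s x) (infinitesimal_generator phi x).
Proof.
move=> [_ _ _ [dphi _]]; apply: DeriveDef; last by rewrite -derive1E.
apply/derivable1_diffP.
(* Joint regularity of the flow is restricted to the line [s |-> (s, x)]. *)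
apply: (@differentiable_comp _ _ _ _ (fun s : R => (s, x))
  (fun p : R * 'rV[R]_d => phi p.1 p.2)); last exact: dphi.
by apply: differentiable_pair.
Qed.

Lemma is_derive_Delta_minus (R : realType) (d : nat) (a b alpha : R) (N : nat)
    (q : R -> 'I_N.+1 -> 'rV[R]_d) (dq : 'I_N.+1 -> 'rV[R]_d) (s : R)
    (k : 'I_N.+1) :
  (forall j, is_derive s 1 (q ^~ j) (dq j)) ->
  is_derive s 1 (fun s => Delta_minus a b alpha (q s) k)
    (Delta_minus a b alpha dq k).
Proof.
move=> hq.
have -> : (fun s => Delta_minus a b alpha (q s) k) =
    (step a b N `^ alpha)^-1 \*:
      \sum_(r < k.+1) (GL_coef alpha r \*: q ^~ (inord (k - r))).
  by apply: funext => z; rewrite /Delta_minus /= fct_sumE.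
apply: is_deriveZ; apply: is_derive_sum => r; exact: is_deriveZ.
Qed.

(** Needed because the regularity of the Lagrangian is given only for times in [[a, b]]. *)
Lemma node_in_itv (R : realType) (a b : R) (N : nat) (k : 'I_N.+1) :
  a <= b -> (0 < N)%N -> a <= node a b k <= b.
Proof.
move=> ab N0; have N0' : (0 : R) < N%:R by rewrite ltr0n.
have ba0 : 0 <= b - a by rewrite subr_ge0.
rewrite /node /step lerDl mulr_ge0 ?divr_ge0 ?ler0n//=.
rewrite -lerBrDl mulrCA ler_piMr// ler_pdivrMr// mul1r ler_nat.
by rewrite -ltnS.
Qed.

Lemma invariance_derivative (R : realType) (d : nat) (a b : R)
    (L : 'rV[R]_d -> 'rV[R]_d -> R -> R) (x v : R -> 'rV[R]_d)
    (dx dv : 'rV[R]_d) (s t : R) :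
  lagrangian a b L -> a <= t <= b ->
  is_derive s 1 x dx -> is_derive s 1 v dv ->
  (forall s', L (x s') (v s') t = L (x s) (v s) t) ->
  dotprod dx (dLdx L (x s) (v s) t) + dotprod dv (dLdv L (x s) (v s) t) = 0.
Proof.
move=> [U [g [_ DU [dg _] Lg]]] tab [/derivable1_diffP ddx xE]
  [/derivable1_diffP ddv vE] Lc.
(* The domain constrains time only, so at this [t] the extension [g] agrees with [L] for all
   positions and velocities; hence the gradients in these variables agree too. *)
have Lgt y w : L y w t = g (y, w, t) by exact: (Lg (y, w, t)).
have dgp : differentiable g (x s, v s, t) by apply/dg/DU.
rewrite /dLdx /dLdv.
rewrite (_ : (fun y => L y (v s) t) = (fun y => g (y, v s, t))); last exact/funext.
rewrite (_ : (fun w => L (x s) w t) = (fun w => g (x s, w, t))); last exact/funext.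
rewrite -diff_dotprod_grad//.
pose c (s' : R) := (x s', v s', t).
have dc : differentiable c s.
  by apply: differentiable_pair => //; exact: differentiable_pair.
have dcE : 'd c s 1 = (dx, dv, 0).
  rewrite /c diff_pair//; last exact: differentiable_pair.
  by rewrite diff_pair// -xE -vE !deriveE// diff_cst.
(* The chain rule read backwards turns the sum into the derivative of [g \o c], a constant
   function. *)
rewrite -dcE -[LHS]/(('d g (c s) \o 'd c s) 1) -diff_comp//.
rewrite (_ : g \o c = cst (g (c s))) ?diff_cst//.
by apply: funext => s'; rewrite /= -!Lgt.
Qed.

Theorem theorem4 (R : realType) (d : nat) (hd : (0 < d)%N)
    (a b : R) (hab : a < b) (alpha : R) (halpha : 0 < alpha <= 1)
    (N : nat) (hN : (2 <= N)%N)
    (L : 'rV[R]_d -> 'rV[R]_d -> R -> R) (hL : lagrangian a b L)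
    (phi : R -> 'rV[R]_d -> 'rV[R]_d) (hphi : one_parameter_group phi)
    (hinv : @Delta_minus_invariant R d a b alpha N L phi)
    (Q : 'I_N.+1 -> 'rV[R]_d) (hQ : discrete_EL a b alpha L Q)
    (k : 'I_N.+1) (hk : (0 < k < N)%N) :
  dotprod
    (Delta_minus a b alpha (fun j => infinitesimal_generator phi (Q j)) k)
    (dLdv L (Q k) (Delta_minus a b alpha Q k) (node a b k))
  - dotprod
    (infinitesimal_generator phi (Q k))
    (Delta_plus a b alpha (momentum a b alpha L Q) k) = 0.
Proof.
have phi0 x : phi 0 x = x by case: hphi => _ ->.
have phiQ0 : (fun j => phi 0 (Q j)) = Q by apply: funext => j; rewrite phi0.
have tab : a <= node a b k <= b.
  by apply: node_in_itv; [exact: ltW | exact: ltnW].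
(* Invariance is restated with the base point written as [phi 0], the value of the curve at the
   parameter where it is differentiated. *)
have inv0 s : L (phi s (Q k)) (Delta_minus a b alpha (fun j => phi s (Q j)) k)
    (node a b k) = L (phi 0 (Q k))
    (Delta_minus a b alpha (fun j => phi 0 (Q j)) k) (node a b k).
  by rewrite !hinv//; case/andP: hk.
have := @invariance_derivative _ _ _ _ _ (fun s => phi s (Q k))
  (fun s => Delta_minus a b alpha (fun j => phi s (Q j)) k) _ _ 0 _ hL tab
  (is_derive_generator _ _ _ _ hphi)
  (is_derive_Delta_minus _ _ _ _ _ _ (fun s j => phi s (Q j)) _ _ _
    (fun j => is_derive_generator _ _ _ (Q j) hphi)) inv0.
(* The zero of the goal is replaced by the vanishing sum, so the velocity terms cancel and the
   Euler-Lagrange equation settles the rest. *)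
rewrite phiQ0 phi0 addrC => <-; congr (_ + _).
by rewrite -dotprodNr; congr dotprod; apply/esym/eqP; rewrite -addr_eq0 hQ.
Qed.
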